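(* Let $0<\gamma<1$ and $k>0$. Suppose $f$ is nonnegative and non-decreasing on $[0,\infty)$ and $u_0\ge0$. Let $\{u^n\}$ with $u^0=u_0$ be given by the explicit scheme $(\mathcal{D}_h^{\gamma}u)_{n+1}=f(u^n)$, $n\ge0$. If $\{w^n\}$ is a sequence (with values in $[0,\infty)$) satisfying $w^0\ge u_0$ and $$(\mathcal{D}_h^{\gamma}w)_{m+1}\ge f(w^m),\qquad 0\le m\le N-1,$$ then $w^n\ge u^n$ for $n\le N$. Correspondingly, if $w^0\le u^0$ and $$(\mathcal{D}_h^{\gamma}w)_{m+1}\le f(w^m),\qquad 0\le m\le N-1,$$ then $w^n\le u^n$ for $n\le N$.
   Context: For a sequence $\{u^n\}_{n\ge0}$, time step $k>0$ and $n\ge0$, $$(\mathcal{D}_h^{\gamma}u)_{n+1}=\frac{1}{\Gamma(2-\gamma)k^{\gamma}}\sum_{m=0}^{n}\big(u^{n+1-m}-u^{n-m}\big)\big[(m+1)^{1-\gamma}-m^{1-\gamma}\big].$$ The explicit scheme $(\mathcal{D}_h^{\gamma}u)_{n+1}=f(u^n)$ determines $u^{n+1}$ uniquely from $u^0,\dots,u^n$. *)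

(* Defs.v *)
From mathcomp Require Import all_boot all_order all_algebra.
From mathcomp Require Import all_classical all_reals all_analysis.

Set Implicit Arguments.
Unset Strict Implicit.
Unset Printing Implicit Defensive.

Import Order.TTheory GRing.Theory Num.Theory.
Import numFieldNormedType.Exports.

Local Open Scope classical_set_scope.
Local Open Scope ring_scope.

(* Euler's integral; it converges only for 0 < z, elsewhere the value is junk. *)
Definition Gamma {R : realType} (z : R) : R :=
  \int[@lebesgue_measure R]_(t in `]0, +oo[) (t `^ (z - 1) * expR (- t)).

(* L1 discretization of the Caputo derivative of order gamma with time step k.
   Pitfall: the argument n yields the value at time index n + 1, so this is
   (D_h^gamma u)_{n+1}. The subtractions of indices do not truncate, as
   m <= n. *)
Definition caputo_disc {R : realType} (gamma k : R) (u : nat -> R) (n : nat) : R :=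
  (Gamma (2 - gamma) * k `^ gamma)^-1 *
  \sum_(m < n.+1) (u (n.+1 - m)%N - u (n - m)%N) *
                  (m.+1%:R `^ (1 - gamma) - m%:R `^ (1 - gamma)).

(* Main.v *)
Require Import Defs.
From mathcomp Require Import all_boot all_order all_algebra.
From mathcomp Require Import all_classical all_reals all_analysis.
From mathcomp Require Import measurable_realfun ring lra.

(** Write [b m = (m+1)^(1-gamma) - m^(1-gamma)] for the weights of the discrete
    derivative.  They satisfy [b 0 = 1 > 0], they are nonnegative because
    powers increase, and they decrease because [t^(1-gamma)] is concave.
    Summation by parts turns the convolution of [b] with the increments of a
    sequence [d] into
      [b 0 * d (n+1) - sum_(m < n) (b m - b (m+1)) * d (n-m) - b n * d 0],
    so that [d (n+1)] is a combination of earlier values with nonnegative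
    coefficients plus a positive multiple of the discrete derivative.  Hence
    nonnegativity propagates: if [d 0, ..., d n] and the discrete derivative at
    time index [n+1] are nonnegative, then so is [d (n+1)]
    ([caputo_disc_ge0]).

    The comparison is this propagation applied to the difference of two
    sequences: the scheme is explicit, so the derivative of the difference at
    index [n+1] is bounded below by a difference of values of [f] at index [n],
    where the order is already known and [f] is monotone.  As [f] is monotone
    only on nonnegative reals, the solution [u] must first be seen to be nonnegative,
    which is the same propagation applied to [u] itself.

    The factor [1 / (Gamma (2 - gamma) * k^gamma)] may be dropped only if it is
    positive.  The integral defining [Gamma] is a real number obtained from an
    extended one, with infinity sent to [0], so positivity of [Gamma] requires
    Euler's integral to be both nonzero and finite ([Gamma_gt0]). *)

Import Order.TTheory GRing.Theory Num.Theory.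
Import numFieldNormedType.Exports.

Local Open Scope classical_set_scope.
Local Open Scope ring_scope.

(** Both cases [t <= 1] and [1 < t] give [t^a <= 1 + t <= 2 (1 + t/2)]. *)
Lemma powR_le_2expR_half (R : realType) (a t : R) :
  0 <= a <= 1 -> 0 <= t -> t `^ a <= 2 * expR (t / 2).
Proof.
move=> /andP[a0 a1] t0.
have e : 1 + t / 2 <= expR (t / 2) by exact: expR_ge1Dx.
suff : t `^ a <= 1 + t by move=> H; lra.
case: (leP t 1) => t1.
  have : t `^ a <= 1 `^ a by apply: ge0_ler_powR; rewrite ?nnegrE.
  by rewrite powR1 => H; lra.
have : t `^ a <= t `^ 1 by apply: ler_powR => //; exact: ltW.
by rewrite powRr1// => H; lra.
Qed.

(** Nonzero: the integrand is at least [exp(-2)] on [1, 2].  Finite: half of the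
    exponential decay absorbs the power of [t], which leaves a multiple of the
    exponential density of rate 1/2, whose integral is known. *)
Lemma Gamma_gt0 (R : realType) (z : R) : 1 <= z <= 2 -> 0 < Gamma z.
Proof.
move=> z12; have a01 : 0 <= z - 1 <= 1 by lra.
have /andP[a0 a1] := a01.
have mD : measurable `]0 : R, +oo[%classic by exact: measurable_itv.
have mf : measurable_fun `]0 : R, +oo[%classic
    (EFin \o (fun t : R => t `^ (z - 1) * expR (- t))).
  apply/measurable_EFinP; apply: measurable_funTS.
  apply: measurable_funM; first exact: measurable_powR.
  by apply: measurableT_comp; [exact: measurable_expR|exact: measurable_funN].
have f0 (t : R) : (0 <= (t `^ (z - 1) * expR (- t))%:E)%E.
  by rewrite lee_fin mulr_ge0 ?powR_ge0 ?expR_ge0.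
rewrite /Gamma /Rintegral; apply: fine_gt0; apply/andP; split.
- have lower : (\int[lebesgue_measure]_(t in `[1%R, 2%R]) (expR (- 2) : R)%:E <=
      \int[lebesgue_measure]_(t in `]0%R, +oo[) (t `^ (z - 1) * expR (- t))%:E)%E.
    have sub : `[1, 2]%classic `<=` `]0 : R, +oo[%classic.
      by move=> t /=; rewrite !in_itv/= => /andP[? ?]; lra.
    apply: le_trans
      (ge0_subset_integral lebesgue_measure _ mD mf (fun t _ => f0 t) sub) => //.
    apply: ge0_le_integral => //.
    + exact: (measurable_funS mD sub mf).
    + move=> t /=; rewrite in_itv/= => /andP[t1 t2].
      rewrite lee_fin -[leLHS]mul1r; apply: ler_pM => //; rewrite ?expR_ge0//.
        by rewrite -[leLHS](powRr0 t); apply: ler_powR.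
      by rewrite ler_expR; lra.
  apply: lt_le_trans lower.
  rewrite integral_cst//= lebesgue_measure_itv/= lte_fin.
  have -> : (1 : R) < 2 by lra.
  by rewrite -EFinB -EFinM lte_fin mulr_gt0 ?expR_gt0//; lra.
- have mexp D : measurable_fun D (EFin \o @exponential_pdf R 2^-1).
    by apply/measurable_EFinP/measurable_funTS; exact: measurable_exponential_pdf.
  have exp_ge0 (t : R) : (0 <= (exponential_pdf 2^-1 t)%:E)%E.
    by rewrite lee_fin exponential_pdf_ge0.
  have upper :
      (\int[lebesgue_measure]_(t in `]0%R, +oo[) (t `^ (z - 1) * expR (- t))%:E
      <= \int[lebesgue_measure]_(t in `]0%R, +oo[)
           ((4 : R)%:E * (exponential_pdf 2^-1 t)%:E))%E.
    apply: ge0_le_integral => //; first exact: (measurable_funeM _ (mexp _)).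
    move=> t /=; rewrite in_itv/= andbT => t0.
    rewrite -EFinM lee_fin exponential_pdfE ?(ltW t0)//.
    have H := powR_le_2expR_half _ _ _ a01 (ltW t0).
    (* 4 is the factor 2 of the power bound, divided by the rate 1/2 which
       multiplies the exponential density. *)
    have -> : - t = - (t / 2) - t / 2 by lra.
    have -> : - 2^-1 * t = - (t / 2) by lra.
    rewrite expRD !mulrA ler_wpM2r ?expR_ge0//.
    rewrite expRN ler_pdivrMr ?expR_gt0//.
    by lra.
  apply: le_lt_trans upper _; rewrite ge0_integralZl//; last exact: mexp.
  apply: lte_mul_pinfty => //.
  apply: (@le_lt_trans _ _ 1%E); last exact: ltry.
  rewrite -[leRHS](@integral_exponential_pdf R 2^-1)//.
  by apply: ge0_subset_integral => //; exact: mexp.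
Qed.

(** Midpoint concavity of [t^a], deduced from the convexity of its inverse
    function [t^(1/a)] at the points [x^a] and [y^a]. *)
Lemma powR_midpoint (R : realType) (a x y : R) : 0 < a <= 1 -> 0 <= x -> 0 <= y ->
  x `^ a + y `^ a <= 2 * ((x + y) / 2) `^ a.
Proof.
move=> /andP[a0 a1] x0 y0.
have aV1 : 1 <= a^-1 by rewrite invf_ge1.
have mid : ((x `^ a + y `^ a) / 2) `^ a^-1 <= (x + y) / 2.
  have xa (s : R) : 0 <= s -> (s `^ a) `^ a^-1 = s.
    by move=> s0; rewrite -powRrM mulfV ?gt_eqF// powRr1.
  have h0 : 0 <= 2^-1 :> R by lra.
  have h1 : 2^-1 <= 1 :> R by lra.
  have := convex_powR aV1 (Itv01 h0 h1) (x := x `^ a) (y := y `^ a).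
  rewrite !inE/= !in_itv/= !andbT => /(_ (powR_ge0 _ _) (powR_ge0 _ _)).
  rewrite [X in X `^ _]convRE convRE/= !xa// /unstable.onem.
  have -> : 2^-1 * x `^ a + (1 - 2^-1) * y `^ a = (x `^ a + y `^ a) / 2 by lra.
  by move=> /le_trans; apply; lra.
have := ge0_ler_powR (ltW a0) _ _ mid.
rewrite -powRrM mulVf ?gt_eqF// powRr1; last first.
  by rewrite divr_ge0// addr_ge0// powR_ge0.
rewrite !nnegrE powR_ge0 divr_ge0 ?addr_ge0// => /(_ isT isT).
by lra.
Qed.

(** Summation by parts, kept as an inequality: dropping the terms
    [(b m - b (m+1)) * d (n-m) >= 0] one at a time, a partial convolution up to
    [j] is bounded by its two boundary terms. *)
Lemma conv_increments_ge0 (R : realDomainType) (b d : nat -> R) (n : nat) :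
  0 < b 0%N -> (forall m, 0 <= b m) -> (forall m, b m.+1 <= b m) ->
  (forall m, (m <= n)%N -> 0 <= d m) ->
  0 <= \sum_(m < n.+1) (d (n.+1 - m)%N - d (n - m)%N) * b m ->
  0 <= d n.+1.
Proof.
move=> b0 b_ge0 b_decr d_ge0 S_ge0.
have key j : (j <= n)%N ->
    \sum_(m < j.+1) (d (n.+1 - m)%N - d (n - m)%N) * b m
      <= d n.+1 * b 0%N - d (n - j)%N * b j.
  elim: j => [_|j IH jn]; first by rewrite big_ord1 !subn0 mulrBl.
  rewrite big_ord_recr/= subSS.
  have := IH (ltnW jn).
  have := ler_wpM2l (d_ge0 (n - j)%N (leq_subr _ _)) (b_decr j).
  rewrite mulrBl; lra.
have := le_trans S_ge0 (key n (leqnn n)).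
rewrite subnn subr_ge0 => H.
by rewrite -(pmulr_lge0 _ b0); apply: le_trans H; rewrite mulr_ge0// d_ge0.
Qed.

Lemma caputo_discB (R : realType) (gamma k : R) (u w : nat -> R) n :
  caputo_disc gamma k (fun i => w i - u i) n =
  caputo_disc gamma k w n - caputo_disc gamma k u n.
Proof.
rewrite /caputo_disc -mulrBr -sumrB; congr (_ * _).
by apply: eq_bigr => m _; ring.
Qed.

(** The discrete maximum principle: the weights decrease by concavity of the
    power, that is by [powR_midpoint] at [m] and [m + 2]. *)
Lemma caputo_disc_ge0 (R : realType) (gamma k : R) (d : nat -> R) n :
  0 < gamma -> gamma < 1 -> 0 < k ->
  (forall m, (m <= n)%N -> 0 <= d m) -> 0 <= caputo_disc gamma k d n ->
  0 <= d n.+1.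
Proof.
move=> g0 g1 k0 d0.
have c_gt0 : 0 < (Gamma (2 - gamma) * k `^ gamma)^-1.
  by rewrite invr_gt0 mulr_gt0 ?powR_gt0// Gamma_gt0//; lra.
rewrite /caputo_disc pmulr_rge0//.
apply: (conv_increments_ge0 _ (fun m => m.+1%:R `^ (1 - gamma) - m%:R `^ (1 - gamma))) => //.
(* Here [0^(1-gamma) = 0] uses [gamma < 1]. *)
- by rewrite powR1 powR0 ?subr0//; lra.
- move=> m; rewrite subr_ge0; apply: ge0_ler_powR; rewrite ?nnegrE ?ler_nat//; lra.
- move=> m.
  have /(_ _ (ler0n _ m) (ler0n _ m.+2)) := @powR_midpoint R (1 - gamma) m%:R m.+2%:R.
  have -> : (m%:R + m.+2%:R) / 2 = m.+1%:R :> R by rewrite -!(natr1 m.+1) -!(natr1 m); lra.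
  have a01 : 0 < 1 - gamma <= 1 by lra.
  by move=> /(_ a01); lra.
Qed.

(** Both halves of the comparison theorem are instances, with the solution of the
    scheme as the lower or as the upper sequence.  The derivatives at index
    [m+1] need to be ordered only where the sequences are ordered at index [m]:
    this is what an explicit scheme with a monotone right-hand side provides. *)
Lemma caputo_disc_comparison (R : realType) (gamma k : R) (v w : nat -> R) N :
  0 < gamma -> gamma < 1 -> 0 < k ->
  v 0%N <= w 0%N ->
  (forall m, (m < N)%N -> v m <= w m ->
    caputo_disc gamma k v m <= caputo_disc gamma k w m) ->
  forall n, (n <= N)%N -> v n <= w n.
Proof.
move=> g0 g1 k0 h0 hs n.
elim/ltn_ind: n => -[//|n] IH nN.
have hd m : (m <= n)%N -> 0 <= w m - v m.
  by move=> mn; rewrite subr_ge0; apply: IH => //; exact: leq_trans mn (ltnW nN).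
rewrite -subr_ge0.
apply: (@caputo_disc_ge0 R gamma k (fun i => w i - v i)) => //.
by rewrite caputo_discB subr_ge0; apply: hs => //; rewrite -subr_ge0 hd.
Qed.

Theorem lemma6p5 (R : realType) (gamma k : R)
    (gamma_gt0 : 0 < gamma) (gamma_lt1 : gamma < 1) (k_gt0 : 0 < k)
    (f : R -> R)
    (f_ge0 : forall x : R, 0 <= x -> 0 <= f x)
    (f_ndecr : forall x y : R, 0 <= x -> x <= y -> f x <= f y)
    (u0 : R) (u0_ge0 : 0 <= u0)
    (u : nat -> R) (u_init : u 0%N = u0)
    (u_scheme : forall n : nat, caputo_disc gamma k u n = f (u n))
    (N : nat) :
  (forall w : nat -> R,
     (forall n : nat, 0 <= w n) ->
     u0 <= w 0%N ->
     (forall m : nat, (m < N)%N -> f (w m) <= caputo_disc gamma k w m) ->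
     forall n : nat, (n <= N)%N -> u n <= w n)
  /\
  (forall w : nat -> R,
     (forall n : nat, 0 <= w n) ->
     w 0%N <= u 0%N ->
     (forall m : nat, (m < N)%N -> caputo_disc gamma k w m <= f (w m)) ->
     forall n : nat, (n <= N)%N -> w n <= u n).
Proof.
have u_ge0 n : 0 <= u n.
  elim/ltn_ind: n => -[_|n IH]; first by rewrite u_init.
  apply: (@caputo_disc_ge0 R gamma k u n) => //.
  by rewrite u_scheme f_ge0// IH.
split=> w w_ge0 w_init w_scheme.
- apply: (@caputo_disc_comparison R gamma k) => //; first by rewrite u_init.
  move=> m mN uw; rewrite u_scheme; apply: le_trans (w_scheme m mN).
  exact: f_ndecr.
- apply: (@caputo_disc_comparison R gamma k) => // m mN wu.
  by rewrite u_scheme; apply: le_trans (w_scheme m mN) _; exact: f_ndecr.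
Qed.
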